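(* Let $f_1, f_2 \colon \mathbb{R} \to \mathbb{C}$ be continuous functions. Then $$f_1(u+v)\, f_2(u-v)\, f_1(u'+v')\, f_2(u'-v') = f_1(u+v')\, f_2(u-v')\, f_1(u'+v)\, f_2(u'-v)$$ holds for all $u,u',v,v' \in \mathbb{R}$ if and only if one of the following conditions holds: (1) $f_1 \equiv 0$. (2) $f_2 \equiv 0$. (3) There exist $d_1,d_2,d_3,d_4,d_5 \in \mathbb{C}$ such that $f_1(u) = e^{d_1u^2 + d_2u + d_3}$ and $f_2(u) = e^{d_1u^2 + d_4u + d_5}$ hold for all $u \in \mathbb{R}$.
   Context: ''One of the conditions holds'' is meant inclusively (at least one). *)

(* Defs.v *)
From Stdlib Require Import Reals.
From Coquelicot Require Import Coquelicot.

(* e^(x + iy) = e^x (cos y + i sin y); Coquelicot has no complex exponential. *)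
Definition Cexp (z : C) : C :=
  Cmult (RtoC (exp (Re z))) (cos (Im z), sin (Im z)).

(* Main.v *)
Require Import Defs.
From Stdlib Require Import Reals Lra Lia ZArith Classical.
From Coquelicot Require Import Coquelicot.

(** If neither function is identically zero, choose x0 and y0 with f1 x0 <> 0
    and f2 y0 <> 0, and put F1 s = f1 (x0 + s) / f1 x0 and
    F2 s = f2 (y0 + s) / f2 y0. The substitution u + v = x0 + s + t,
    u - v = y0 + s - t turns the four-variable equation into

      F1 (s + t) F2 (s - t) = F1 s * F2 s * F1 t * F2 (- t),  F1 0 = F2 0 = 1.

    The pairs exp (d s^2 + b1 s), exp (d s^2 + b2 s) solve this equation, and
    the quotient of a solution by such a Gaussian pair is again a solution
    ([qexp_solution]). On a small interval [-r, r] both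
    F1 and F2 stay near 1, so logarithms with small imaginary part exist there.
    Both products F1 s * F1 (-s) and F2 s * F2 (-s) agree
    ([solution_even_parts]), and this is exactly the compatibility that lets a
    single Gaussian pair match the four values F1 r, F1 (-r), F2 r, F2 (-r).
    Dividing by that pair gives a solution G1, G2 equal to 1 at r and -r whose
    values on [-r, r] lie in the right half-plane.

    Such a pair is identically 1. Doubling expresses the values at 2 s through
    those at s and -s; in logarithms, doubling and the equality of the even
    parts form a linear system with only the zero solution, and the half-plane bound excludes nontrivial roots of unity, so
    the value 1 passes from 2 s to s ([one_at_half]), hence to all r / 2^n.
    The equation then carries it to all integer multiples of r / 2^n
    ([one_at_int_multiple]). These points are dense, so
    continuity gives that F1 and F2 are the Gaussian pair everywhere. *)

Open Scope R_scope.

(** * The complex exponential and its logarithms *)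

Lemma Cexp_plus (z w : C) : Cexp (z + w)%C = (Cexp z * Cexp w)%C.
Proof.
  destruct z as [a b], w as [c d].
  unfold Cexp; simpl.
  rewrite exp_plus, cos_plus, sin_plus.
  apply injective_projections; simpl; ring.
Qed.

Lemma Cexp_0 : Cexp (RtoC 0) = RtoC 1.
Proof.
  unfold Cexp; simpl; rewrite exp_0, cos_0, sin_0.
  apply injective_projections; simpl; ring.
Qed.

Lemma Cexp_opp_r (z : C) : (Cexp z * Cexp (- z))%C = RtoC 1.
Proof.
  rewrite <- Cexp_plus, <- Cexp_0; f_equal; ring.
Qed.

Lemma Cexp_eq_1_small (w : C) :
  Cexp w = RtoC 1 -> Rabs (Im w) < 2 * PI -> w = RtoC 0.
Proof.
  destruct w as [x y]; unfold Cexp; simpl; intros H Hy.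
  injection H; intros Hs Hc.
  pose proof (exp_pos x) as Hx.
  pose proof (sin2_cos2 y) as Hsc; unfold Rsqr in Hsc.
  assert (Hs' : sin y = 0) by nra.
  assert (Hc' : exp x * cos y = 1) by nra.
  rewrite Hs' in Hsc.
  assert (Hcy : cos y = 1) by nra.
  assert (Hx1 : exp x = 1) by nra.
  rewrite <- exp_0 in Hx1; apply exp_inv in Hx1.
  assert (Hy2 : sin (y / 2) = 0).
  { pose proof (cos_2a_sin (y / 2)) as E.
    replace (2 * (y / 2)) with y in E by field. nra. }
  apply Rabs_def2 in Hy.
  assert (Hy0 : y = 0).
  { destruct (Rtotal_order y 0) as [Hn | [He | Hp]]; auto.
    - assert (0 < sin (- (y / 2))) by (apply sin_gt_0; lra).
      rewrite sin_neg in *; lra.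
    - assert (0 < sin (y / 2)) by (apply sin_gt_0; lra). lra. }
  subst; reflexivity.
Qed.

Lemma unit_circle_param (x y : R) :
  x * x + y * y = 1 -> exists t, Rabs t <= PI /\ cos t = x /\ sin t = y.
Proof.
  intros H.
  assert (Hx : -1 <= x <= 1) by nra.
  pose proof (acos_bound x) as Hb.
  assert (Hs : sin (acos x) = Rabs y).
  { rewrite sin_acos by assumption.
    rewrite <- sqrt_Rsqr_abs; f_equal; unfold Rsqr; lra. }
  destruct (Rle_dec 0 y) as [Hy | Hy].
  - exists (acos x).
    rewrite Hs, cos_acos, !Rabs_pos_eq by lra. lra.
  - exists (- acos x).
    rewrite sin_neg, cos_neg, Hs, cos_acos by lra.
    rewrite Rabs_Ropp, Rabs_pos_eq, Rabs_left by lra. lra.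
Qed.

Lemma Cexp_surj (z : C) :
  z <> RtoC 0 -> exists w, z = Cexp w /\ Rabs (Im w) <= PI.
Proof.
  intros Hz.
  pose proof (Cmod_gt_0 z) as Hm; apply Hm in Hz; clear Hm.
  assert (Hsq : Cmod z * Cmod z = Re z * Re z + Im z * Im z).
  { unfold Cmod; rewrite sqrt_sqrt; unfold Re, Im; nra. }
  set (m := Cmod z) in *.
  destruct (unit_circle_param (Re z / m) (Im z / m)) as (t & Ht & Hc & Hs).
  { transitivity ((Re z * Re z + Im z * Im z) / (m * m)); [field; lra|].
    rewrite <- Hsq; field; lra. }
  exists (ln m, t); split; [|exact Ht].
  unfold Cexp; simpl; rewrite exp_ln, Hc, Hs by assumption.
  apply injective_projections; unfold Re, Im in *; simpl; field; lra.
Qed.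

(** The sector of half-angle a around the positive real axis is described by a
    condition linear in Re z and |Im z|, which is an open condition on z; with
    y = Im w the hypothesis reads sin (|y| - a) < 0. *)
Lemma Cexp_sector (w : C) (a : R) :
  0 < a < PI -> Rabs (Im w) <= PI ->
  Rabs (Im (Cexp w)) * cos a < sin a * Re (Cexp w) -> Rabs (Im w) < a.
Proof.
  intros Ha Hw H.
  destruct w as [x y]; unfold Cexp, Re, Im in *; simpl in *.
  pose proof (exp_pos x) as Hx.
  apply Rnot_le_lt; intros Hay.
  assert (Hs : 0 <= sin (Rabs y - a)) by (apply sin_ge_0; lra).
  rewrite sin_minus in Hs.
  assert (Hcos : cos (Rabs y) = cos y).
  { unfold Rabs; destruct (Rcase_abs y); auto using cos_neg. }
  assert (Hsin : sin (Rabs y) = Rabs (sin y)).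
  { rewrite <- (Rabs_pos_eq (sin (Rabs y))) by (apply sin_ge_0; auto using Rabs_pos).
    unfold Rabs at 2; destruct (Rcase_abs y); auto.
    now rewrite sin_neg, Rabs_Ropp. }
  rewrite Hcos, Hsin in Hs.
  replace (exp x * sin y + 0 * cos y) with (exp x * sin y) in H by ring.
  rewrite Rabs_mult, (Rabs_pos_eq (exp x)) in H by lra.
  nra.
Qed.

(** * Continuity, and agreement on a dyadic grid *)

Lemma continuous_Re (f : R -> C) (x : R) :
  continuous f x -> continuous (fun t => Re (f t)) x.
Proof.
  intros H; apply (continuous_comp f (@fst R R)); [exact H|].
  destruct (f x) as [a b].
  exact (continuous_fst (U := R_UniformSpace) (V := R_UniformSpace) a b).
Qed.

Lemma continuous_Im (f : R -> C) (x : R) :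
  continuous f x -> continuous (fun t => Im (f t)) x.
Proof.
  intros H; apply (continuous_comp f (@snd R R)); [exact H|].
  destruct (f x) as [a b].
  exact (continuous_snd (U := R_UniformSpace) (V := R_UniformSpace) a b).
Qed.

Lemma continuous_pos_nbhd (h : R -> R) (x : R) :
  continuous h x -> 0 < h x ->
  exists r, 0 < r /\ forall s, Rabs (s - x) < r -> 0 < h s.
Proof.
  intros Hc Hp.
  destruct (Hc (fun y => 0 < y) (open_gt 0 (h x) Hp)) as [r Hr].
  exists r; split; [apply cond_pos|]. exact Hr.
Qed.

(** The sector condition of [Cexp_sector] is open and holds at the value 1. *)
Lemma small_log (F : R -> C) (a : R) :
  0 < a < PI -> continuous F 0 -> F 0 = RtoC 1 ->
  exists r, 0 < r /\
    forall s, Rabs s <= r -> exists w, F s = Cexp w /\ Rabs (Im w) < a.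
Proof.
  intros Ha Hc H1.
  destruct (continuous_pos_nbhd
    (fun s => sin a * Re (F s) - Rabs (Im (F s)) * cos a) 0) as (r & Hr & Hpos).
  - apply (continuous_minus (V := R_NormedModule)).
    + apply (continuous_scal_r (V := R_NormedModule) (sin a) (fun s => Re (F s))).
      now apply continuous_Re.
    + apply (continuous_mult (K := R_AbsRing) (fun s => Rabs (Im (F s)))).
      * apply (continuous_comp (fun s => Im (F s)) Rabs).
        -- now apply continuous_Im.
        -- apply continuous_Rabs.
      * apply continuous_const.
  - rewrite H1; simpl; rewrite Rabs_R0.
    pose proof (sin_gt_0 a); lra.
  - exists (r / 2); split; [lra|]; intros s Hs.
    specialize (Hpos s); rewrite Rminus_0_r in Hpos.
    assert (Hp : 0 < sin a * Re (F s) - Rabs (Im (F s)) * cos a)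
      by (apply Hpos; lra).
    destruct (Cexp_surj (F s)) as (w & Hw & Hi).
    { intros E; rewrite E in Hp; simpl in Hp; rewrite Rabs_R0 in Hp; lra. }
    exists w; split; [exact Hw|].
    apply Cexp_sector; auto. rewrite <- Hw; lra.
Qed.

Lemma dyadic_approx (r x d : R) :
  0 < r -> 0 < d -> exists (n : nat) (k : Z), Rabs (IZR k * (r / 2 ^ n) - x) < d.
Proof.
  intros Hr Hd.
  destruct (pow_lt_1_zero (/ 2)) with (y := d / r) as [n Hn].
  { rewrite Rabs_pos_eq; lra. }
  { now apply Rdiv_lt_0_compat. }
  specialize (Hn n (le_n n)).
  pose proof (pow_lt 2 n ltac:(lra)) as H2.
  assert (Ht : 0 < r / 2 ^ n < d).
  { split; [now apply Rdiv_lt_0_compat|].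
    rewrite pow_inv, Rabs_pos_eq in Hn by (apply Rlt_le, Rinv_0_lt_compat, H2).
    apply (Rmult_lt_compat_l r) in Hn; auto.
    replace (r * (d / r)) with d in Hn by (field; lra). exact Hn. }
  set (t := r / 2 ^ n) in *.
  destruct (base_Int_part (x / t)) as [Ha Hb].
  exists n, (Int_part (x / t)); fold t.
  assert (Hx : x = x / t * t) by (field; lra).
  apply Rabs_def1; nra.
Qed.

Lemma continuous_eq_on_dyadics (f g : R -> R) (r : R) :
  0 < r ->
  (forall x, continuous f x) -> (forall x, continuous g x) ->
  (forall (n : nat) (k : Z), f (IZR k * (r / 2 ^ n)) = g (IZR k * (r / 2 ^ n))) ->
  forall x, f x = g x.
Proof.
  intros Hr Hf Hg H x.
  apply NNPP; intros Hne.
  destruct (continuous_pos_nbhd (fun y => Rabs (f y - g y)) x) as (d & Hd & Hpos).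
  - apply (continuous_comp (fun y => f y - g y) Rabs).
    + now apply (continuous_minus (V := R_NormedModule)).
    + apply continuous_Rabs.
  - apply Rabs_pos_lt; lra.
  - destruct (dyadic_approx r x d Hr Hd) as (n & k & Hnk).
    apply Hpos in Hnk.
    rewrite H, Rminus_diag, Rabs_R0 in Hnk; lra.
Qed.

(** * The normalized functional equation *)

Definition normalized_solution (F1 F2 : R -> C) : Prop :=
  F1 0 = RtoC 1 /\ F2 0 = RtoC 1 /\
  forall s t, (F1 (s + t)%R * F2 (s - t)%R)%C
            = (F1 s * F2 s * F1 t * F2 (- t)%R)%C.

(** The cases t = s and t = -s of the equation. *)
Lemma solution_double (F1 F2 : R -> C) (s : R) :
  normalized_solution F1 F2 ->
  F1 (2 * s) = (F1 s * F1 s * F2 s * F2 (- s)%R)%C /\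
  F2 (2 * s) = (F2 s * F2 s * F1 s * F1 (- s)%R)%C.
Proof.
  intros (H1 & H2 & H); split.
  - pose proof (H s s) as E.
    replace (s + s) with (2 * s) in E by ring.
    replace (s - s) with 0 in E by ring.
    rewrite H2, Cmult_1_r in E. rewrite E; ring.
  - pose proof (H s (- s)) as E.
    replace (s + - s) with 0 in E by ring.
    replace (s - - s) with (2 * s) in E by ring.
    rewrite H1, Cmult_1_l, Ropp_involutive in E. rewrite E; ring.
Qed.

(** By the doubling formulas at s/2 and -s/2, both sides are the square of
    F1 (s/2) F1 (-s/2) F2 (s/2) F2 (-s/2). *)
Lemma solution_even_parts (F1 F2 : R -> C) (s : R) :
  normalized_solution F1 F2 ->
  (F1 s * F1 (- s)%R)%C = (F2 s * F2 (- s)%R)%C.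
Proof.
  intros H.
  destruct (solution_double F1 F2 (s / 2) H) as [A1 A2].
  destruct (solution_double F1 F2 (- (s / 2)) H) as [B1 B2].
  replace (2 * (s / 2)) with s in * by field.
  replace (2 * - (s / 2)) with (- s) in * by field.
  rewrite Ropp_involutive in *.
  rewrite A1, A2, B1, B2; ring.
Qed.

Definition one_at (G1 G2 : R -> C) (s : R) : Prop :=
  G1 s = RtoC 1 /\ G1 (- s) = RtoC 1 /\ G2 s = RtoC 1 /\ G2 (- s) = RtoC 1.

Lemma one_at_opp (G1 G2 : R -> C) (s : R) :
  one_at G1 G2 s -> one_at G1 G2 (- s).
Proof.
  unfold one_at; rewrite Ropp_involutive; tauto.
Qed.

(** The bound PI / 2 is one quarter of 2 PI, because the relations to which it
    is applied involve four logarithms each. *)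
Definition half_plane_logs (G : R -> C) (r : R) : Prop :=
  forall s, Rabs s <= r -> exists w, G s = Cexp w /\ Rabs (Im w) < PI / 2.

(** Write a, a', b, b' for logarithms of G1 s, G1 (-s), G2 s, G2 (-s). Doubling
    gives 2a + b + b' = 2a' + b + b' = 0 and 2b + a + a' = 2b' + a + a' = 0.
    This system alone has the solutions a = a' = -b = -b'; the equality of the
    even parts, a + a' = b + b', leaves only zero. *)
Lemma one_at_half (G1 G2 : R -> C) (r s : R) :
  normalized_solution G1 G2 -> half_plane_logs G1 r -> half_plane_logs G2 r ->
  Rabs s <= r -> one_at G1 G2 (2 * s) -> one_at G1 G2 s.
Proof.
  intros H L1 L2 Hs (E1 & E1' & E2 & E2').
  assert (Hs' : Rabs (- s) <= r) by now rewrite Rabs_Ropp.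
  destruct (solution_double G1 G2 s H) as [A1 A2].
  destruct (solution_double G1 G2 (- s) H) as [B1 B2].
  pose proof (solution_even_parts G1 G2 s H) as Ev.
  replace (2 * - s) with (- (2 * s)) in * by ring.
  rewrite Ropp_involutive in *.
  rewrite E1 in A1; rewrite E2 in A2; rewrite E1' in B1; rewrite E2' in B2.
  destruct (L1 s Hs) as (a & Ha & Ia), (L1 (- s) Hs') as (a' & Ha' & Ia').
  destruct (L2 s Hs) as (b & Hb & Ib), (L2 (- s) Hs') as (b' & Hb' & Ib').
  rewrite Ha, Ha', Hb, Hb' in *.
  apply Rabs_def2 in Ia; apply Rabs_def2 in Ia'.
  apply Rabs_def2 in Ib; apply Rabs_def2 in Ib'.
  (* A sum of four such logarithms has imaginary part below 2 PI in
     absolute value, so multiplicative relations become linear ones. *)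
  assert (R1 : (a + a + b + b')%C = RtoC 0).
  { apply Cexp_eq_1_small; [rewrite !Cexp_plus; now symmetry|].
    unfold Im in *; simpl; apply Rabs_def1; lra. }
  assert (R2 : (b + b + a + a')%C = RtoC 0).
  { apply Cexp_eq_1_small; [rewrite !Cexp_plus; now symmetry|].
    unfold Im in *; simpl; apply Rabs_def1; lra. }
  assert (R1' : (a' + a' + b' + b)%C = RtoC 0).
  { apply Cexp_eq_1_small; [rewrite !Cexp_plus; now symmetry|].
    unfold Im in *; simpl; apply Rabs_def1; lra. }
  assert (R2' : (b' + b' + a' + a)%C = RtoC 0).
  { apply Cexp_eq_1_small; [rewrite !Cexp_plus; now symmetry|].
    unfold Im in *; simpl; apply Rabs_def1; lra. }
  assert (R3 : (a + a' + - b + - b')%C = RtoC 0).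
  { apply Cexp_eq_1_small.
    - rewrite !Cexp_plus, Ev.
      transitivity ((Cexp b * Cexp (- b)) * (Cexp b' * Cexp (- b')))%C; [ring|].
      rewrite !Cexp_opp_r; ring.
    - unfold Im in *; simpl; apply Rabs_def1; lra. }
  clear - Ha Ha' Hb Hb' R1 R2 R1' R2' R3.
  destruct a as [ax ay], a' as [ax' ay'], b as [bx b_y], b' as [bx' by'].
  unfold RtoC in *; unfold Cplus, Copp in *; simpl in *.
  injection R1; injection R2; injection R1'; injection R2'; injection R3; intros.
  unfold one_at; rewrite Ha, Ha', Hb, Hb'.
  assert (Z : forall x y, x = 0 -> y = 0 -> Cexp (x, y) = RtoC 1).
  { intros x y -> ->; exact Cexp_0. }
  repeat split; apply Z; lra.
Qed.

Lemma one_at_dyadic (G1 G2 : R -> C) (r : R) :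
  0 < r -> normalized_solution G1 G2 ->
  half_plane_logs G1 r -> half_plane_logs G2 r ->
  one_at G1 G2 r -> forall n : nat, one_at G1 G2 (r / 2 ^ n).
Proof.
  intros Hr H L1 L2 H0 n; induction n as [|n IH].
  - simpl; now rewrite Rdiv_1_r.
  - apply (one_at_half G1 G2 r); auto.
    + rewrite Rabs_pos_eq.
      * apply Rmult_le_reg_r with (2 ^ S n); [apply pow_lt; lra|].
        pose proof (pow_R1_Rle 2 (S n) ltac:(lra)).
        unfold Rdiv; rewrite Rmult_assoc, Rinv_l by (apply pow_nonzero; lra).
        nra.
      * apply Rlt_le, Rdiv_lt_0_compat; auto; apply pow_lt; lra.
    + replace (2 * (r / 2 ^ S n)) with (r / 2 ^ n); auto.
      simpl; field; apply pow_nonzero; lra.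
Qed.

(** Induction on two consecutive multiples: at s = (n + 1) t, the increments t
    and -t give G1 ((n + 2) t) G2 (n t) = 1 and G1 (n t) G2 ((n + 2) t) = 1. *)
Lemma one_at_nat_multiple (G1 G2 : R -> C) (t : R) :
  normalized_solution G1 G2 -> one_at G1 G2 t ->
  forall n : nat, G1 (INR n * t) = RtoC 1 /\ G2 (INR n * t) = RtoC 1.
Proof.
  intros (H1 & H2 & H) (E1 & E1' & E2 & E2').
  assert (P : forall n : nat,
    (G1 (INR n * t) = RtoC 1 /\ G2 (INR n * t) = RtoC 1) /\
    (G1 (INR (S n) * t) = RtoC 1 /\ G2 (INR (S n) * t) = RtoC 1)).
  { induction n as [|n [[A1 A2] [B1 B2]]].
    - simpl; rewrite Rmult_0_l, Rmult_1_l; auto.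
    - split; [auto|].
      pose proof (H (INR (S n) * t) t) as P1.
      pose proof (H (INR (S n) * t) (- t)) as P2.
      rewrite Ropp_involutive in P2.
      replace (INR (S n) * t + t) with (INR (S (S n)) * t) in P1
        by (rewrite (S_INR (S n)); ring).
      replace (INR (S n) * t - - t) with (INR (S (S n)) * t) in P2
        by (rewrite (S_INR (S n)); ring).
      replace (INR (S n) * t - t) with (INR n * t) in P1
        by (rewrite (S_INR n); ring).
      replace (INR (S n) * t + - t) with (INR n * t) in P2
        by (rewrite (S_INR n); ring).
      rewrite B1, B2, E1, E2', A2, !Cmult_1_r in P1.
      rewrite B1, B2, E1', E2, A1, !Cmult_1_r, Cmult_1_l in P2.
      auto. }
  intros n; apply P.
Qed.

Lemma one_at_int_multiple (G1 G2 : R -> C) (t : R) :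
  normalized_solution G1 G2 -> one_at G1 G2 t ->
  forall k : Z, G1 (IZR k * t) = RtoC 1 /\ G2 (IZR k * t) = RtoC 1.
Proof.
  intros H E k.
  destruct (Z_le_dec 0 k) as [Hk | Hk].
  - rewrite <- (Z2Nat.id k), <- INR_IZR_INZ by lia.
    now apply one_at_nat_multiple.
  - replace (IZR k * t) with (INR (Z.to_nat (- k)) * - t).
    + apply one_at_nat_multiple; auto using one_at_opp.
    + rewrite INR_IZR_INZ, Z2Nat.id, opp_IZR by lia; ring.
Qed.

(** * Dividing by a Gaussian pair *)

Definition qexp (d b : C) (s : R) : C := Cexp (d * RtoC s ^ 2 + b * RtoC s)%C.

Lemma qexp_continuous (d b : C) (x : R) :
  continuous (fun s => Re (qexp d b s)) x /\ continuous (fun s => Im (qexp d b s)) x.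
Proof.
  destruct d as [dx dy], b as [bx b_y].
  set (p := fun s => dx * s ^ 2 + bx * s).
  set (q := fun s => dy * s ^ 2 + b_y * s).
  assert (Q : forall s, qexp (dx, dy) (bx, b_y) s = (exp (p s) * cos (q s), exp (p s) * sin (q s))).
  { intros s; unfold qexp, Cexp.
    replace ((dx, dy) * RtoC s ^ 2 + (bx, b_y) * RtoC s)%C with (p s, q s).
    - apply injective_projections; simpl; ring.
    - apply injective_projections; unfold p, q; simpl; ring. }
  split.
  - apply continuous_ext with (fun s => exp (p s) * cos (q s)).
    { intros s; rewrite Q; reflexivity. }
    unfold p, q; apply (ex_derive_continuous (K := R_AbsRing) (V := R_NormedModule)).
    auto_derive; auto.
  - apply continuous_ext with (fun s => exp (p s) * sin (q s)).
    { intros s; rewrite Q; reflexivity. }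
    unfold p, q; apply (ex_derive_continuous (K := R_AbsRing) (V := R_NormedModule)).
    auto_derive; auto.
Qed.

(** A quotient of two solutions is a solution; the two exponents share their
    quadratic coefficient because (s + t)^2 + (s - t)^2 = 2 s^2 + 2 t^2 has no
    mixed term. *)
Lemma qexp_solution (F1 F2 : R -> C) (d b1 b2 : C) :
  normalized_solution F1 F2 ->
  normalized_solution (fun s => (F1 s * qexp (- d) (- b1) s)%C)
                      (fun s => (F2 s * qexp (- d) (- b2) s)%C).
Proof.
  intros (H1 & H2 & H).
  assert (Q0 : forall c b, qexp c b 0 = RtoC 1).
  { intros c b; unfold qexp; rewrite <- Cexp_0; f_equal; ring. }
  split; [rewrite H1, Q0; ring|].
  split; [rewrite H2, Q0; ring|].
  intros s t.
  assert (Q : (qexp (- d) (- b1) (s + t) * qexp (- d) (- b2) (s - t))%C =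
    (qexp (- d) (- b1) s * qexp (- d) (- b2) s *
     (qexp (- d) (- b1) t * qexp (- d) (- b2) (- t)))%C).
  { unfold qexp; rewrite <- !Cexp_plus; f_equal.
    rewrite RtoC_minus, RtoC_plus, RtoC_opp; ring. }
  transitivity ((F1 (s + t)%R * F2 (s - t)%R) *
    (qexp (- d) (- b1) (s + t) * qexp (- d) (- b2) (s - t)))%C; [ring|].
  rewrite H, Q; ring.
Qed.

Lemma qexp_cancel (d b z : C) (s : R) :
  (z * qexp (- d) (- b) s)%C = RtoC 1 -> z = qexp d b s.
Proof.
  intros E.
  assert (E' : (qexp d b s * qexp (- d) (- b) s)%C = RtoC 1).
  { unfold qexp; rewrite <- Cexp_plus, <- Cexp_0; f_equal; ring. }
  transitivity (z * (qexp d b s * qexp (- d) (- b) s))%C.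
  - rewrite E'; ring.
  - transitivity (qexp d b s * (z * qexp (- d) (- b) s))%C; [ring|].
    rewrite E; ring.
Qed.

Lemma eq_qexp_of_dyadics (F : R -> C) (d b : C) (r : R) :
  0 < r -> (forall x, continuous F x) ->
  (forall (n : nat) (k : Z),
     F (IZR k * (r / 2 ^ n)) = qexp d b (IZR k * (r / 2 ^ n))) ->
  forall s, F s = qexp d b s.
Proof.
  intros Hr CF E s; apply injective_projections.
  - apply (continuous_eq_on_dyadics (fun s => Re (F s)) (fun s => Re (qexp d b s)) r Hr).
    + intros x; exact (continuous_Re F x (CF x)).
    + intros x; exact (proj1 (qexp_continuous d b x)).
    + intros n k; now rewrite E.
  - apply (continuous_eq_on_dyadics (fun s => Im (F s)) (fun s => Im (qexp d b s)) r Hr).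
    + intros x; exact (continuous_Im F x (CF x)).
    + intros x; exact (proj2 (qexp_continuous d b x)).
    + intros n k; now rewrite E.
Qed.

(** Scaling the coefficients by r keeps the subtracted exponent
    D (s/r)^2 + B (s/r) bounded by its coefficients on [-r, r]; the budget
    PI / 8 + 3 (PI / 8) is exactly PI / 2. *)
Lemma half_plane_logs_quotient (F : R -> C) (D B : C) (r : R) :
  0 < r ->
  (forall s, Rabs s <= r -> exists w, F s = Cexp w /\ Rabs (Im w) < PI / 8) ->
  Rabs (Im D) + Rabs (Im B) <= 3 * (PI / 8) ->
  half_plane_logs
    (fun s => (F s * qexp (- (D / RtoC r ^ 2)) (- (B / RtoC r)) s)%C) r.
Proof.
  intros Hr S HB s Hs.
  assert (Hr0 : RtoC r <> RtoC 0) by (intros E; apply RtoC_inj in E; lra).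
  destruct (S s Hs) as (w & Hw & Iw).
  exists (w - (D * RtoC (s / r) ^ 2 + B * RtoC (s / r)))%C; split.
  - rewrite Hw; unfold qexp; rewrite <- Cexp_plus; f_equal.
    rewrite RtoC_div by lra; field; auto.
  - assert (Hu : Rabs (s / r) <= 1).
    { unfold Rdiv; rewrite Rabs_mult, Rabs_inv, (Rabs_pos_eq r) by lra.
      apply Rmult_le_reg_r with r; auto.
      rewrite Rmult_assoc, Rinv_l; lra. }
    set (u := s / r) in *.
    replace (Im (w - (D * RtoC u ^ 2 + B * RtoC u))%C)
      with (Im w - (Im D * (u * u) + Im B * u))
      by (unfold Im; simpl; ring).
    pose proof (Rabs_triang (Im w) (- (Im D * (u * u) + Im B * u))) as T1.
    pose proof (Rabs_triang (Im D * (u * u)) (Im B * u)) as T2.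
    rewrite Rabs_Ropp in T1; rewrite !Rabs_mult in T2.
    pose proof (Rabs_pos u); pose proof (Rabs_pos (Im D)); pose proof (Rabs_pos (Im B)).
    assert (Rabs u * Rabs u <= 1) by nra.
    unfold Rminus; nra.
Qed.

(** The exponent D (s/r)^2 + B1 (s/r) interpolates logarithms l and l' of F1 at
    r and -r, and B2 is chosen to fit F2 at r. The value of F2 at -r then fits
    by [solution_even_parts]. *)
Lemma normalized_solution_qexp (F1 F2 : R -> C) :
  (forall x : R, continuous F1 x) -> (forall x : R, continuous F2 x) ->
  normalized_solution F1 F2 ->
  exists d b1 b2, forall s, F1 s = qexp d b1 s /\ F2 s = qexp d b2 s.
Proof.
  intros C1 C2 H.
  pose proof PI_RGT_0 as Hpi.
  destruct (small_log F1 (PI / 8)) as (r1 & Hr1 & S1);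
    [lra | apply C1 | apply H |].
  destruct (small_log F2 (PI / 8)) as (r2 & Hr2 & S2);
    [lra | apply C2 | apply H |].
  assert (HR : exists r, 0 < r /\ r <= r1 /\ r <= r2).
  { exists (Rmin r1 r2); split; [now apply Rmin_glb_lt|].
    split; [apply Rmin_l | apply Rmin_r]. }
  destruct HR as (r & Hr & Hrr1 & Hrr2).
  assert (Ar : Rabs r = r) by (apply Rabs_pos_eq; lra).
  destruct (S1 r) as (l & Hl & Il); [lra|].
  destruct (S1 (- r)) as (l' & Hl' & Il'); [rewrite Rabs_Ropp; lra|].
  destruct (S2 r) as (m & Hm & Im_m); [lra|].
  assert (Hr0 : RtoC r <> RtoC 0) by (intros E; apply RtoC_inj in E; lra).
  assert (H20 : RtoC 2 <> RtoC 0) by (intros E; apply RtoC_inj in E; lra).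
  set (D := ((l + l') / 2)%C).
  set (B1 := ((l - l') / 2)%C).
  set (B2 := (m - D)%C).
  set (d := (D / RtoC r ^ 2)%C).
  set (b1 := (B1 / RtoC r)%C).
  set (b2 := (B2 / RtoC r)%C).
  exists d, b1, b2.
  set (G1 := fun s => (F1 s * qexp (- d) (- b1) s)%C).
  set (G2 := fun s => (F2 s * qexp (- d) (- b2) s)%C).
  assert (HG : normalized_solution G1 G2) by now apply qexp_solution.
  assert (Hone : one_at G1 G2 r).
  { pose proof (solution_even_parts F1 F2 r H) as Ev.
    rewrite Hl, Hl', Hm, <- Cexp_plus in Ev.
    assert (Hm' : F2 (- r) = Cexp (l + l' - m)%C).
    { unfold Cminus; rewrite Cexp_plus, Ev.
      transitivity ((Cexp m * Cexp (- m)) * F2 (- r)%R)%C; [|ring].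
      rewrite Cexp_opp_r; ring. }
    unfold one_at, G1, G2; rewrite Hl, Hl', Hm, Hm'.
    unfold qexp; rewrite <- !Cexp_plus, RtoC_opp, <- Cexp_0.
    unfold d, b1, b2, B2, B1, D.
    repeat split; f_equal; field; auto. }
  apply Rabs_def2 in Il; apply Rabs_def2 in Il'; apply Rabs_def2 in Im_m.
  assert (ID : Im D = (Im l + Im l') / 2) by (unfold D, Im; simpl; field).
  assert (IB1 : Im B1 = (Im l - Im l') / 2) by (unfold B1, Im; simpl; field).
  assert (IB2 : Im B2 = Im m - (Im l + Im l') / 2) by (rewrite <- ID; reflexivity).
  assert (AD : Rabs (Im D) <= PI / 8) by (rewrite ID; apply Rabs_le; lra).
  assert (AB1 : Rabs (Im B1) <= 2 * (PI / 8)) by (rewrite IB1; apply Rabs_le; lra).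
  assert (AB2 : Rabs (Im B2) <= 2 * (PI / 8)) by (rewrite IB2; apply Rabs_le; lra).
  assert (L1 : half_plane_logs G1 r).
  { apply (half_plane_logs_quotient F1 D B1 r Hr); [|lra].
    intros s Hs; apply S1; lra. }
  assert (L2 : half_plane_logs G2 r).
  { apply (half_plane_logs_quotient F2 D B2 r Hr); [|lra].
    intros s Hs; apply S2; lra. }
  assert (Gdy : forall (n : nat) (k : Z),
    G1 (IZR k * (r / 2 ^ n)) = RtoC 1 /\ G2 (IZR k * (r / 2 ^ n)) = RtoC 1).
  { intros n k; apply one_at_int_multiple; auto.
    now apply one_at_dyadic. }
  intros s; split.
  - apply (eq_qexp_of_dyadics F1 d b1 r Hr C1).
    intros n k; apply qexp_cancel, Gdy.
  - apply (eq_qexp_of_dyadics F2 d b2 r Hr C2).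
    intros n k; apply qexp_cancel, Gdy.
Qed.

(** * Reduction to the normalized equation *)

Lemma continuous_Re_Im (f : R -> C) (x : R) :
  continuous (fun t => Re (f t)) x -> continuous (fun t => Im (f t)) x ->
  continuous f x.
Proof.
  intros Hre Him P [eps HP].
  pose proof (Hre _ (locally_ball (Re (f x)) eps)) as Bre.
  pose proof (Him _ (locally_ball (Im (f x)) eps)) as Bim.
  unfold filtermap in *.
  generalize (filter_and _ _ Bre Bim).
  apply filter_imp; intros t Ht; apply HP; exact Ht.
Qed.

Lemma continuous_normalize (f : R -> C) (x0 : R) :
  (forall x, continuous f x) ->
  forall x, continuous (fun s => f (x0 + s)%R * / f x0)%C x.
Proof.
  intros Hf x.
  assert (Hs : continuous (fun s : R => f (x0 + s)) x).
  { apply (continuous_comp (fun s : R => x0 + s) f); [|apply Hf].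
    apply (ex_derive_continuous (K := R_AbsRing) (V := R_NormedModule)).
    auto_derive; auto. }
  assert (Hk : forall (g : R -> R) (k : R), continuous g x -> continuous (fun s => g s * k) x).
  { intros g k Hg; apply (continuous_mult (K := R_AbsRing) g); auto.
    apply continuous_const. }
  pose proof (continuous_Re _ _ Hs) as Hre; pose proof (continuous_Im _ _ Hs) as Him.
  apply continuous_Re_Im; unfold Re, Im; simpl.
  - apply (continuous_minus (V := R_NormedModule)); now apply Hk.
  - apply (continuous_plus (V := R_NormedModule)); now apply Hk.
Qed.

Theorem corollary1p2 (f1 f2 : R -> C)
    (hf1 : forall x : R, continuous f1 x)
    (hf2 : forall x : R, continuous f2 x) :
  (forall u u' v v' : R,
     (f1 (u + v)%R * f2 (u - v)%R * f1 (u' + v')%R * f2 (u' - v')%R)%C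
     = (f1 (u + v')%R * f2 (u - v')%R * f1 (u' + v)%R * f2 (u' - v)%R)%C)
  <->
  ((forall u : R, f1 u = RtoC 0)
   \/ (forall u : R, f2 u = RtoC 0)
   \/ (exists d1 d2 d3 d4 d5 : C,
         forall u : R,
           f1 u = Cexp (d1 * RtoC u ^ 2 + d2 * RtoC u + d3)%C
           /\ f2 u = Cexp (d1 * RtoC u ^ 2 + d4 * RtoC u + d5)%C)).
Proof.
  split.
  - intros H.
    destruct (classic (forall u, f1 u = RtoC 0)) as [Z1 | Z1]; [now left|].
    destruct (classic (forall u, f2 u = RtoC 0)) as [Z2 | Z2]; [now right; left|].
    right; right.
    apply not_all_ex_not in Z1; destruct Z1 as [x0 Hx].
    apply not_all_ex_not in Z2; destruct Z2 as [y0 Hy].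
    set (F1 := fun s : R => (f1 (x0 + s)%R * / f1 x0)%C).
    set (F2 := fun s : R => (f2 (y0 + s)%R * / f2 y0)%C).
    destruct (normalized_solution_qexp F1 F2) as (d & b1 & b2 & HF).
    + now apply continuous_normalize.
    + now apply continuous_normalize.
    + unfold normalized_solution, F1, F2.
      rewrite !Rplus_0_r.
      split; [now apply Cinv_r|]; split; [now apply Cinv_r|].
      intros s t.
      (* u and v are chosen so that (u + v, u - v) = (x0 + s + t, y0 + s - t). *)
      pose proof (H ((x0 + y0) / 2 + s) ((x0 + y0) / 2)
                    ((x0 - y0) / 2 + t) ((x0 - y0) / 2)) as E.
      replace ((x0 + y0) / 2 + s + ((x0 - y0) / 2 + t)) with (x0 + (s + t)) in E by field.
      replace ((x0 + y0) / 2 + s - ((x0 - y0) / 2 + t)) with (y0 + (s - t)) in E by field.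
      replace ((x0 + y0) / 2 + (x0 - y0) / 2) with x0 in E by field.
      replace ((x0 + y0) / 2 - (x0 - y0) / 2) with y0 in E by field.
      replace ((x0 + y0) / 2 + s + (x0 - y0) / 2) with (x0 + s) in E by field.
      replace ((x0 + y0) / 2 + s - (x0 - y0) / 2) with (y0 + s) in E by field.
      replace ((x0 + y0) / 2 + ((x0 - y0) / 2 + t)) with (x0 + t) in E by field.
      replace ((x0 + y0) / 2 - ((x0 - y0) / 2 + t)) with (y0 + - t) in E by field.
      set (p := f1 x0) in *; set (q := f2 y0) in *.
      transitivity ((f1 (x0 + (s + t))%R * f2 (y0 + (s - t))%R * p * q)
                    / (p * p * q * q))%C; [field; auto|].
      rewrite E; field; auto.
    + destruct (Cexp_surj _ Hx) as (l1 & Hl1 & _).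
      destruct (Cexp_surj _ Hy) as (l2 & Hl2 & _).
      exists d, (b1 - 2 * d * RtoC x0)%C, (d * RtoC x0 ^ 2 - b1 * RtoC x0 + l1)%C,
        (b2 - 2 * d * RtoC y0)%C, (d * RtoC y0 ^ 2 - b2 * RtoC y0 + l2)%C.
      assert (T : forall (f : R -> C) (z0 : R) (b l : C),
        f z0 <> RtoC 0 -> f z0 = Cexp l ->
        (forall s, (f (z0 + s)%R * / f z0)%C = qexp d b s) ->
        forall u, f u = Cexp (d * RtoC u ^ 2 + (b - 2 * d * RtoC z0) * RtoC u +
                              (d * RtoC z0 ^ 2 - b * RtoC z0 + l))%C).
      { intros f z0 b l Hz Hl E u.
        specialize (E (u - z0)).
        replace (z0 + (u - z0)) with u in E by ring.
        transitivity (f u * / f z0 * f z0)%C; [field; auto|].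
        rewrite E, Hl; unfold qexp; rewrite <- Cexp_plus; f_equal.
        rewrite RtoC_minus; ring. }
      intros u; split; apply T; auto; intros s; apply HF.
  - intros [H | [H | (d1 & d2 & d3 & d4 & d5 & H)]] u u' v v'.
    + rewrite !H; ring.
    + rewrite !H; ring.
    + assert (A1 : forall x, f1 x = Cexp (d1 * RtoC x ^ 2 + d2 * RtoC x + d3)%C)
        by apply H.
      assert (A2 : forall x, f2 x = Cexp (d1 * RtoC x ^ 2 + d4 * RtoC x + d5)%C)
        by apply H.
      rewrite !A1, !A2, <- !Cexp_plus; f_equal.
      rewrite !RtoC_minus, !RtoC_plus; ring.
Qed.
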